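(* Let $(X,\le)$ be a finite regular $\wedge$-semilattice of height $n$ with top level $\Omega$. Let $t\in\{0,\ldots,n\}$ and let $D\subseteq\Omega$ be a Steiner system of strength $t$. For each block $B\in D$, the block intersection distribution at $B$ is given by $$\alpha_r(B)=\begin{cases}\displaystyle\sum_{s=r}^{t-1}\nu'(r,s)\,\nu(s,n)\left(\frac{\theta(s)}{\theta(t)}-1\right)&\text{if }r\in\{0,\ldots,t-1\},\\ 0&\text{if }r\in\{t,\ldots,n-1\},\\ 1&\text{if }r=n.\end{cases}$$ In particular, the block intersection distribution is uniquely determined by the strength $t$ and the regularity parameters of the ambient poset.
   Context: Let $(X,\le)$ be a finite non-empty $\wedge$-semilattice; it has a bottom element $\bot$. For $a\le b$ in $X$, the length $\ell(a,b)$ is the largest $r$ such that there is a chain $a=x_0<x_1<\cdots<x_r=b$. The height of $a$ is $h(a)=\ell(\bot,a)$, and $n=h(X)=\max_{x\in X}h(x)$ is the height of the poset. The levels are $X_r=\{x\in X: h(x)=r\}$ for $r\in\{0,\ldots,n\}$, and the top level is $\Omega=X_n$. The poset is called regular if the following hold. (R$\theta$) For all $r\in\{0,\ldots,n\}$, the number $\theta(r)=\#\{x\in\Omega: a\le x\}$ is the same for all $a\in X_r$. (R$\mu$) For all $r,s\in\{0,\ldots,n\}$, the number $\mu(r,s)=\#\{x\in X_s: a\le x\le b\}$ is the same for all $(a,b)\in X_r\times\Omega$ with $a\le b$. (R$\nu$) For all $r,s\in\{0,\ldots,n\}$, the number $\nu(r,s)=\#\{x\in X_r: x\le a\}$ is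 the same for all $a\in X_s$ (so $\nu(r,s)=0$ for $r>s$). The numbers $\theta(r),\mu(r,s),\nu(r,s)$ are the regularity parameters. The matrix $(\nu(r,s))_{r,s\in\{0,\ldots,n\}}$ is upper triangular with ones on the diagonal, hence invertible; its inverse is denoted $(\nu'(r,s))_{r,s\in\{0,\ldots,n\}}$. A set $D\subseteq\Omega$ is a Steiner system of strength $t$ if for every $x\in X_t$ there is exactly one $y\in D$ with $x\le y$. Its elements are called blocks. For $B\in D$ and $r\in\{0,\ldots,n\}$, $\alpha_r(B)=\#\{y\in D: h(y\wedge B)=r\}$; the sequence $(\alpha_0(B),\ldots,\alpha_n(B))$ is the block intersection distribution at $B$. *)

(* Defs.v *)
From mathcomp Require Import all_boot all_order all_algebra.

Set Implicit Arguments.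
Unset Strict Implicit.
Unset Printing Implicit Defensive.

Import Order.TTheory GRing.Theory Num.Theory.

Lemma lt_path_size (d : Order.disp_t) (X : finPOrderType d) (a : X)
    (s : seq X) : path <%O a s -> (size s < #|X|)%N.
Proof.
move=> a_s; have: uniq (a :: s) by apply: (sorted_uniq lt_trans lt_irreflexive).
by move/card_uniqP => /= <-; exact: max_card.
Qed.

(* A chain a < x_1 < ... < x_r = b is encoded by its tail [:: x_1; ...; x_r].
   By lt_path_size, restricting the maximum to r < #|X| loses no chain. *)
Definition chain_length (d : Order.disp_t) (X : finPOrderType d) (a b : X)
    : nat :=
  \max_(r < #|X|
      | [exists s : r.-tuple X, path <%O a s && (last a s == b)]) r.

(* A finBMeetSemilatticeType is exactly a finite non-empty meet-semilattice:
   the bottom is the meet of all the elements. *)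
Definition elt_height (d : Order.disp_t) (X : finBMeetSemilatticeType d)
    (a : X) : nat := chain_length \bot%O a.

Definition height (d : Order.disp_t) (X : finBMeetSemilatticeType d) : nat :=
  \max_(x : X) elt_height x.

Definition level (d : Order.disp_t) (X : finBMeetSemilatticeType d) (r : nat)
    : {set X} := [set x : X | elt_height x == r].

Definition top_level (d : Order.disp_t) (X : finBMeetSemilatticeType d)
    : {set X} := level X (height X).

(* X is regular, with regularity parameters theta, mu and nu. The values of the
   parameters at arguments outside {0, ..., height X} are unconstrained. *)
Record regular (d : Order.disp_t) (X : finBMeetSemilatticeType d)
    (theta : nat -> nat) (mu nu : nat -> nat -> nat) : Prop := Regular {
  regular_theta : forall (r : 'I_(height X).+1) (a : X), a \in level X r ->
    #|[set x in top_level X | (a <= x)%O]| = theta r;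
  regular_mu : forall (r s : 'I_(height X).+1) (a b : X),
    a \in level X r -> b \in top_level X -> (a <= b)%O ->
    #|[set x in level X s | (a <= x <= b)%O]| = mu r s;
  regular_nu : forall (r s : 'I_(height X).+1) (a : X), a \in level X s ->
    #|[set x in level X r | (x <= a)%O]| = nu r s
}.

Definition nu_mx (n : nat) (nu : nat -> nat -> nat) : 'M[rat]_n.+1 :=
  (\matrix_(r < n.+1, s < n.+1) (nu r s)%:R)%R.

(* The inverse is taken over the rationals. For the parameters of a regular
   semilattice of height n, nu_mx n nu is unitriangular, so that invmx is the
   true inverse. *)
Definition nu_inv (n : nat) (nu : nat -> nat -> nat) : 'M[rat]_n.+1 :=
  invmx (nu_mx n nu).

Definition steiner_system (d : Order.disp_t) (X : finBMeetSemilatticeType d)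
    (t : nat) (D : {set X}) : Prop :=
  D \subset top_level X /\
  (forall x : X, x \in level X t -> exists! y : X, y \in D /\ (x <= y)%O).

Definition block_intersection (d : Order.disp_t)
    (X : finBMeetSemilatticeType d) (D : {set X}) (B : X) (r : nat) : nat :=
  #|[set y in D | elt_height (y `&` B)%O == r]|.

(* Main.v *)
Require Import Defs.
From mathcomp Require Import all_boot all_order all_algebra.

Set Implicit Arguments.
Unset Strict Implicit.
Unset Printing Implicit Defensive.

Import Order.TTheory GRing.Theory Num.Theory.

Local Open Scope ring_scope.

(**
Write [n] for the height of [X] and [alpha r] for [block_intersection D B r].
Two blocks that share a lower bound of height [t] coincide, so [alpha r = 0]
for [t <= r < n] and [alpha n = 1]; only the values at [r < t] are unknown.

They are found by counting, for each [s < t], the pairs [(x, y)] with [x] of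
height [s], [y] a block and [x <= y `&` B]. Sorting by the height of [y `&` B]
gives [\sum_r nu s r * alpha r] ([nu_block_intersection]). Sorting by [x], each
of the [nu s n] elements [x] of height [s] below [B] lies below exactly
[theta s / theta t] blocks ([steiner_degree]): counting the [z] of height [t]
above [x], once along the blocks above [z] and once along all the top elements
above [z], yields the same factor [mu s t] on both sides. Removing the
contribution [nu s n] of [B] itself leaves the linear system
[\sum_(r < t) nu s r * alpha r = nu s n * (theta s / theta t - 1)].

The matrix [nu] is upper unitriangular, so the system extends to all [s] with
right-hand side [0] for [s >= t], and applying the inverse matrix solves it. The
inverse is again upper triangular, whence the summation range [r <= s < t].

The resulting expression depends only on [n], [t], [theta] and [nu], which gives
the independence from the chosen semilattice, system and block.
*)

(** * Chains and heights *)

Lemma size_le_chain_length (d : Order.disp_t) (X : finPOrderType d) (a : X)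
    (s : seq X) :
  path <%O a s -> (size s <= chain_length a (last a s))%N.
Proof.
move=> a_s; pose i := Ordinal (lt_path_size a_s).
apply: (@leq_bigmax_cond _ _ (fun r : 'I_#|X| => r : nat) i).
by apply/existsP; exists (in_tuple s); rewrite a_s eqxx.
Qed.

Lemma chain_length_attained (d : Order.disp_t) (X : finPOrderType d) (a b : X) :
  (a <= b)%O ->
  exists s, [/\ path <%O a s, last a s = b & size s = chain_length a b].
Proof.
move=> le_ab.
have [s0 a_s0 s0b] : exists2 s, path <%O a s & last a s = b.
  move: le_ab; rewrite le_eqVlt => /predU1P[->|lt_ab]; first by exists [::].
  by exists [:: b]; rewrite //= lt_ab.
pose ok (r : 'I_#|X|) :=
  [exists s : r.-tuple X, path <%O a s && (last a s == b)].
have ok0 : (0 < #|ok|)%N.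
  apply/card_gt0P; exists (Ordinal (lt_path_size a_s0)).
  by apply/existsP; exists (in_tuple s0); rewrite a_s0 s0b eqxx.
have [r /existsP[s /andP[a_s /eqP sb]] r_max] :=
  eq_bigmax_cond (fun r : 'I_#|X| => r : nat) ok0.
by exists s; rewrite a_s sb size_tuple; split=> //.
Qed.

Lemma elt_height_lt (d : Order.disp_t) (X : finBMeetSemilatticeType d)
    (x y : X) :
  (x < y)%O -> (elt_height x < elt_height y)%N.
Proof.
move=> lt_xy; rewrite /elt_height.
have [s [bot_s sx <-]] := chain_length_attained (le0x x).
have := @size_le_chain_length _ X \bot%O (rcons s y).
by rewrite rcons_path bot_s sx lt_xy last_rcons size_rcons; apply.
Qed.

Lemma elt_height_le (d : Order.disp_t) (X : finBMeetSemilatticeType d)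
    (x y : X) :
  (x <= y)%O -> (elt_height x <= elt_height y)%N.
Proof. by rewrite le_eqVlt => /predU1P[->//|/elt_height_lt/ltnW]. Qed.

Lemma elt_height_eq (d : Order.disp_t) (X : finBMeetSemilatticeType d)
    (x y : X) :
  (x <= y)%O -> (elt_height y <= elt_height x)%N -> x = y.
Proof.
rewrite le_eqVlt => /predU1P[//|/elt_height_lt lt_xy].
by rewrite leqNgt lt_xy.
Qed.

Lemma elt_height_le_height (d : Order.disp_t) (X : finBMeetSemilatticeType d)
    (x : X) : (elt_height x <= height X)%N.
Proof. exact: leq_bigmax. Qed.

(** The last but one element of a longest chain from the bottom to [x] has
height exactly one less than [x]: at least, by the truncated chain, and at most,
by strict monotonicity. Iterating descends through every height.

Regularity says nothing about empty levels; this lemma supplies the elements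
that show the parameters to be positive where that is needed. *)
Lemma exists_below_of_height (d : Order.disp_t)
    (X : finBMeetSemilatticeType d) (x : X) (r : nat) :
  (r <= elt_height x)%N -> exists2 z, (z <= x)%O & elt_height z = r.
Proof.
move E: (elt_height x) => k; elim: k x E => [|k IHk] x hx.
  by rewrite leqn0 => /eqP->; exists x.
rewrite leq_eqVlt => /predU1P[->|]; first by exists x.
rewrite ltnS => le_rk.
have [s [bot_s sx size_s]] := chain_length_attained (le0x x).
rewrite -[chain_length _ _]/(elt_height x) hx in size_s.
case/lastP: s => [//|s y] in bot_s sx size_s *.
rewrite last_rcons in sx; rewrite {y}sx in bot_s size_s *.
rewrite rcons_path in bot_s; case/andP: bot_s => bot_s lt_sx.
rewrite size_rcons in size_s; case: size_s => size_s.
have hs : elt_height (last \bot%O s) = k.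
  apply/eqP; rewrite eqn_leq -ltnS -hx elt_height_lt //=.
  by rewrite -size_s size_le_chain_length.
have [z le_zs hz] := IHk _ hs le_rk.
by exists z => //; apply: le_trans le_zs (ltW lt_sx).
Qed.

(** * Counting blocks above an element *)

Lemma double_count (I J : finType) (A : {set I}) (C : {set J})
    (R : I -> J -> bool) :
  (\sum_(x in A) #|[set y in C | R x y]| =
   \sum_(y in C) #|[set x in A | R x y]|)%N.
Proof.
under eq_bigr do rewrite -sum1_card.
under [RHS]eq_bigr do rewrite -sum1_card.
rewrite (exchange_big_dep [in C]) /= => [|x y _].
  by apply: eq_bigr => y yC; apply: eq_bigl => x; rewrite !inE yC.
by rewrite inE => /andP[].
Qed.

(** The pairs [x <= z <= y] with [z] of height [t] and [y] in [E], counted by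
[z] and by [y]. Taking for [E] both a Steiner system and the whole top level
lets [mu] cancel in the comparison. *)
Lemma count_intermediate (d : Order.disp_t) (X : finBMeetSemilatticeType d)
    (theta : nat -> nat) (mu nu : nat -> nat -> nat)
    (hX : regular X theta mu nu) (s t : 'I_(height X).+1) (x : X)
    (E : {set X}) :
  x \in level X s -> E \subset top_level X ->
  (\sum_(z in [set z in level X t | (x <= z)%O]) #|[set y in E | (z <= y)%O]|
   = #|[set y in E | (x <= y)%O]| * mu s t)%N.
Proof.
move=> xs /subsetP sE; rewrite double_count.
rewrite (bigID (fun y => (x <= y)%O)) /= [X in (_ + X)%N]big1 => [|y].
  rewrite addn0 -sum_nat_const; apply: eq_big => [y|y /andP[yE le_xy]].
    by rewrite !inE.
  rewrite -(regular_mu hX t xs (sE y yE) le_xy); apply: eq_card => z.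
  by rewrite !inE -andbA.
case/andP=> _ /negP nle_xy; apply/eqP; rewrite cards_eq0.
apply/eqP/setP => z; rewrite !inE; apply/negP.
by case/andP=> /andP[_ le_xz] le_zy; apply: nle_xy; apply: le_trans le_zy.
Qed.

(** The degree [theta s / theta t], free of division: both sides agree after
multiplication by [mu s t], which is positive because a block has elements of
heights [s <= t] in a chain below it. *)
Lemma steiner_degree (d : Order.disp_t) (X : finBMeetSemilatticeType d)
    (theta : nat -> nat) (mu nu : nat -> nat -> nat)
    (hX : regular X theta mu nu) (s t : 'I_(height X).+1) (D : {set X})
    (hD : steiner_system t D) (B : X) (hB : B \in D) (x : X) :
  (s <= t)%N -> x \in level X s ->
  (#|[set y in D | (x <= y)%O]| * theta t = theta s)%N.
Proof.
move=> le_st xs; case: hD => sD uD; have /subsetP/(_ B hB) := sD.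
rewrite inE => /eqP hBn.
have [z le_zB hz] : exists2 z, (z <= B)%O & elt_height z = t.
  by apply: exists_below_of_height; rewrite hBn -ltnS.
have [w le_wz hw] : exists2 w, (w <= z)%O & elt_height w = s.
  by apply: exists_below_of_height; rewrite hz.
have mu_gt0 : (0 < mu s t)%N.
  rewrite -(@regular_mu _ _ _ _ _ hX s t w B).
  - by apply/card_gt0P; exists z; rewrite !inE hz eqxx le_wz.
  - by rewrite inE hw.
  - by rewrite inE hBn.
  - exact: le_trans le_zB.
pose Z := [set z in level X t | (x <= z)%O].
have countD : (#|[set y in D | (x <= y)%O]| * mu s t = #|Z|)%N.
  rewrite -(count_intermediate hX) // -sum1_card; apply: eq_bigr => v.
  rewrite inE => /andP[vt _]; have [y [[yD le_vy] uy]] := uD v vt.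
  rewrite -(cards1 y); apply: eq_card => u; rewrite !inE.
  by apply/andP/eqP => [[uDD le_vu]|->]; [rewrite (uy u) | split].
have countT : (theta s * mu s t = #|Z| * theta t)%N.
  rewrite -(regular_theta hX xs) -(count_intermediate hX) // -sum_nat_const.
  by apply: eq_bigr => v; rewrite inE => /andP[/(regular_theta hX)].
by apply/eqP; rewrite -(eqn_pmul2r mu_gt0) countT -countD mulnAC.
Qed.

(** * Positivity and triangularity of the parameters *)

Lemma theta_gt0 (d : Order.disp_t) (X : finBMeetSemilatticeType d)
    (theta : nat -> nat) (mu nu : nat -> nat -> nat)
    (hX : regular X theta mu nu) (B : X) (hB : B \in top_level X)
    (r : 'I_(height X).+1) : (0 < theta r)%N.
Proof.
have hBn : elt_height B = height X by move: hB; rewrite inE => /eqP.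
have [z le_zB hz] : exists2 z, (z <= B)%O & elt_height z = r.
  by apply: exists_below_of_height; rewrite hBn -ltnS.
rewrite -(@regular_theta _ _ _ _ _ hX r z); last by rewrite inE hz.
by apply/card_gt0P; exists B; rewrite inE hB.
Qed.

Lemma nu_diag (d : Order.disp_t) (X : finBMeetSemilatticeType d)
    (theta : nat -> nat) (mu nu : nat -> nat -> nat)
    (hX : regular X theta mu nu) (B : X) (hB : B \in top_level X)
    (r : 'I_(height X).+1) : nu r r = 1%N.
Proof.
have hBn : elt_height B = height X by move: hB; rewrite inE => /eqP.
have [z _ hz] : exists2 z, (z <= B)%O & elt_height z = r.
  by apply: exists_below_of_height; rewrite hBn -ltnS.
rewrite -(@regular_nu _ _ _ _ _ hX r r z); last by rewrite inE hz.
rewrite -(cards1 z); apply: eq_card => x; rewrite !inE.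
apply/andP/eqP => [[/eqP hx le_xz]|->]; last by rewrite hz.
by apply: elt_height_eq le_xz _; rewrite hz hx.
Qed.

Lemma nu_lower (d : Order.disp_t) (X : finBMeetSemilatticeType d)
    (theta : nat -> nat) (mu nu : nat -> nat -> nat)
    (hX : regular X theta mu nu) (B : X) (hB : B \in top_level X)
    (r s : 'I_(height X).+1) : (s < r)%N -> nu r s = 0%N.
Proof.
move=> lt_sr.
have hBn : elt_height B = height X by move: hB; rewrite inE => /eqP.
have [z _ hz] : exists2 z, (z <= B)%O & elt_height z = s.
  by apply: exists_below_of_height; rewrite hBn -ltnS.
rewrite -(@regular_nu _ _ _ _ _ hX r s z); last by rewrite inE hz.
apply/eqP; rewrite cards_eq0; apply/eqP/setP => x; rewrite !inE.
apply/negP => /andP[/eqP hx /elt_height_le].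
by rewrite hx hz leqNgt lt_sr.
Qed.

Lemma unitriangular_unitmx (K : comUnitRingType) (n : nat) (M : 'M[K]_n) :
  (forall i, M i i = 1) -> (forall i j : 'I_n, (j < i)%N -> M i j = 0) ->
  M \in unitmx.
Proof.
move=> M1 M0; rewrite unitmxE -det_tr det_trig.
  by rewrite big1 ?unitr1 // => i _; rewrite mxE M1.
by apply/is_trig_mxP => i j lt_ij; rewrite mxE M0.
Qed.

(** In the entry [(i, j)] of [M *m invmx M = 1], the diagonal term is
[invmx M i j], the earlier terms vanish since [M] is upper triangular, and the
later ones vanish by descending induction on the row. *)
Lemma invmx_unitriangular (K : comUnitRingType) (n : nat) (M : 'M[K]_n) :
  (forall i, M i i = 1) -> (forall i j : 'I_n, (j < i)%N -> M i j = 0) ->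
  forall i j : 'I_n, (j < i)%N -> invmx M i j = 0.
Proof.
move=> M1 M0 i j; have [m] := ubnP (n - i)%N; elim: m i => // m IHm i.
rewrite ltnS => le_nim lt_ji.
have /matrixP/(_ i j) := mulmxV (unitriangular_unitmx M1 M0).
rewrite !mxE -val_eqE gtn_eqF //= (bigD1 i) //= M1 mul1r.
rewrite big1 ?addr0 // => k; rewrite -val_eqE /=.
case: (ltngtP k i) => // [lt_ki|lt_ik] _.
  by rewrite M0 // mul0r.
rewrite IHm ?mulr0 ?(ltn_trans lt_ji) //.
by apply: leq_trans le_nim; rewrite ltn_sub2l // ltn_ord.
Qed.

(** * The intersection numbers of a block *)

(** Counts the pairs [(x, y)] with [x] of height [s], [y] in [D] and
[x <= y `&` B], on the left by the height of [y `&` B] and on the right by [x].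
*)
Lemma nu_block_intersection (d : Order.disp_t)
    (X : finBMeetSemilatticeType d)
    (theta : nat -> nat) (mu nu : nat -> nat -> nat)
    (hX : regular X theta mu nu) (s : 'I_(height X).+1) (D : {set X}) (B : X) :
  (\sum_(r < (height X).+1) nu s r * block_intersection D B r =
   \sum_(x in [set x in level X s | (x <= B)%O])
      #|[set y in D | (x <= y)%O]|)%N.
Proof.
rewrite double_count.
pose h y : 'I_(height X).+1 := inord (elt_height (y `&` B)%O).
have hE y : h y = elt_height (y `&` B)%O :> nat.
  by rewrite inordK // ltnS elt_height_le_height.
rewrite (partition_big h predT) //=; apply: eq_bigr => r _.
rewrite mulnC -sum_nat_const; apply: eq_big => y.
  by rewrite !inE -val_eqE /= hE.
rewrite inE => /andP[_ /eqP hr].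
rewrite -(@regular_nu _ _ _ _ _ hX s r (y `&` B)%O); last by rewrite inE hr.
by apply: eq_card => x; rewrite !inE lexI -andbA; congr (_ && _); rewrite andbC.
Qed.

(** An element of height [t] below the meet lies below only one block. *)
Lemma steiner_block_unique (d : Order.disp_t)
    (X : finBMeetSemilatticeType d) (t : nat) (D : {set X})
    (hD : steiner_system t D) (y z : X) :
  y \in D -> z \in D -> (t <= elt_height (y `&` z)%O)%N -> y = z.
Proof.
move=> yD zD /exists_below_of_height[x].
rewrite lexI => /andP[le_xy le_xz] hx.
have [|u [_ uu]] := hD.2 x; first by rewrite inE hx.
by rewrite -(uu y) // (uu z).
Qed.

Lemma block_intersection_high (d : Order.disp_t)
    (X : finBMeetSemilatticeType d) (t : nat) (D : {set X})
    (hD : steiner_system t D) (B : X) (hB : B \in D) (r : nat) :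
  (t <= r)%N -> block_intersection D B r = (r == height X).
Proof.
move=> le_tr; have /subsetP/(_ B hB) := hD.1; rewrite inE => /eqP hBn.
transitivity (#|[set y in [set B] | height X == r]|).
  apply: eq_card => y; rewrite !inE; apply/andP/andP => -[].
    move=> yD /eqP hy; have eq_yB : y = B.
      by apply: (steiner_block_unique hD) => //; rewrite hy.
    by rewrite -hy eq_yB meetxx hBn.
  by move=> /eqP-> hr; rewrite meetxx hBn.
rewrite eq_sym; case: eqP => _ /=.
  by rewrite -(cards1 B); apply: eq_card => y; rewrite !inE andbT.
by apply: eq_card0 => y; rewrite !inE andbF.
Qed.

(** The equation [height X = n] is separated from the formula so that the
right-hand sides for two semilattices of the same height are literally the same
term. *)
Lemma block_intersection_formula (d : Order.disp_t)
    (X : finBMeetSemilatticeType d)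
    (theta : nat -> nat) (mu nu : nat -> nat -> nat)
    (hX : regular X theta mu nu) (n : nat) (hn : height X = n)
    (t : 'I_n.+1) (D : {set X}) (hD : steiner_system t D) (B : X)
    (hB : B \in D) (r : 'I_n.+1) :
  (block_intersection D B r)%:R =
    if (r < t)%N then
      \sum_(s < n.+1 | (r <= s < t)%N)
        nu_inv n nu r s * (nu s n)%:R * ((theta s)%:R / (theta t)%:R - 1)
    else if (r < n)%N then 0
    else 1 :> rat.
Proof.
subst n; have topB : B \in top_level X by have /subsetP := hD.1; apply.
have [lt_rt|le_tr] := ltnP r t; last first.
  rewrite (block_intersection_high hD) //.
  by rewrite ltn_neqAle -[(_ <= height X)%N]ltnS ltn_ord andbT; case: eqP.
have M1 i : nu_mx (height X) nu i i = 1 by rewrite mxE (nu_diag hX topB).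
have M0 (i j : 'I_(height X).+1) : (j < i)%N -> nu_mx (height X) nu i j = 0.
  by move=> lt_ji; rewrite mxE (nu_lower hX topB).
(* Only the intersection numbers below t are unknown; padding them with 0 makes
   the system square. *)
pose a : 'cV[rat]_(height X).+1 :=
  \col_i if (i < t)%N then (block_intersection D B i)%:R else 0.
pose c : 'cV[rat]_(height X).+1 :=
  \col_s if (s < t)%N then
    (nu s (height X))%:R * ((theta s)%:R / (theta t)%:R - 1) else 0.
have theta_t : (theta t)%:R != 0 :> rat.
  by rewrite pnatr_eq0 -lt0n (theta_gt0 hX topB).
have Ma : nu_mx (height X) nu *m a = c.
  apply/colP => s; rewrite !mxE; have [lt_st|le_ts] := ltnP s t; last first.
    apply: big1 => i _; rewrite [a _ _]mxE.
    case: ifP => [lt_it|_]; last by rewrite mulr0.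
    by rewrite M0 ?mul0r // (leq_trans lt_it).
  (* Both cases agree: for i < t <= n the correction is 0, and for t <= i it is
     the whole intersection number. *)
  have aE (i : 'I_(height X).+1) :
      a i 0 = (block_intersection D B i)%:R - (i == ord_max)%:R.
    rewrite mxE -val_eqE /=; case: ltnP => [lt_it|le_ti].
      by rewrite ltn_eqF ?subr0 // (leq_trans lt_it) // -ltnS.
    by rewrite (block_intersection_high hD) // subrr.
  under eq_bigr do rewrite aE mxE mulrBr -natrM.
  rewrite sumrB -natr_sum (nu_block_intersection hX).
  rewrite (bigD1 (ord_max : 'I_(height X).+1)) //= eqxx mulr1.
  rewrite [X in _ - (_ + X)]big1 ?addr0 => [|i /negPf->]; last by rewrite mulr0.
  rewrite mulrBr mulr1; congr (_ - _).
  apply: (mulIf theta_t); rewrite mulrA divfK // -!natrM; congr _%:R.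
  rewrite big_distrl /=.
  rewrite -(@regular_nu _ _ _ _ _ hX s ord_max B topB) -sum_nat_const.
  apply: eq_bigr => x; rewrite inE => /andP[xs _].
  exact: (steiner_degree hX hD hB (ltnW lt_st) xs).
have -> : (block_intersection D B r)%:R = a r 0 by rewrite mxE lt_rt.
rewrite -(mulKmx (unitriangular_unitmx M1 M0) a) Ma mxE.
rewrite [RHS]big_mkcond; apply: eq_bigr => s _; rewrite [c _ _]mxE.
have [lt_sr|le_rs] := ltnP s r.
  by rewrite (invmx_unitriangular M1 M0) ?mul0r.
by case: ifP; rewrite ?mulr0 // mulrA.
Qed.

Theorem theorem5 (d : Order.disp_t) (X : finBMeetSemilatticeType d)
    (theta : nat -> nat) (mu nu : nat -> nat -> nat)
    (hX : regular X theta mu nu)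
    (t : 'I_(height X).+1) (D : {set X}) (hD : steiner_system t D)
    (B : X) (hB : B \in D) :
  (forall r : 'I_(height X).+1,
     (block_intersection D B r)%:R =
       if (r < t)%N then
         \sum_(s < (height X).+1 | (r <= s < t)%N)
           nu_inv (height X) nu r s * (nu s (height X))%:R
             * ((theta s)%:R / (theta t)%:R - 1)
       else if (r < height X)%N then 0
       else 1 :> rat)
  /\
  (forall (d' : Order.disp_t) (X' : finBMeetSemilatticeType d')
      (D' : {set X'}) (B' : X'),
     height X' = height X -> regular X' theta mu nu ->
     steiner_system t D' -> B' \in D' ->
     forall r : 'I_(height X).+1,
       block_intersection D' B' r = block_intersection D B r).
Proof.
split=> [r|d' X' D' B' hn' hX' hD' hB' r].
  exact: (block_intersection_formula hX erefl hD hB).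
apply/eqP; rewrite -(eqr_nat rat) (block_intersection_formula hX erefl hD hB).
by rewrite (block_intersection_formula hX' hn' hD' hB').
Qed.
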